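(* Let $\precsim$ be a compatible q.o on an abelian group $G$ and let $v:G\to\Gamma\cup\{\infty\}$ be a valuation. The following statements are equivalent: 1. For every $\gamma\in\Gamma$, $G^\gamma$ is $\precsim$-convex in $G$. 2. For every $\gamma\in\Gamma$, $G_\gamma$ is $\precsim$-convex in $G$. 3. For every $\gamma\in\Gamma$, $\precsim$ induces a compatible q.o $\precsim_\gamma$ on $G^\gamma/G_\gamma$. 4. $v$ is compatible with $\precsim$. Moreover, when these hold, $\precsim$ is valuational (respectively, a group order) if and only if each $\precsim_\gamma$ ($\gamma\in\Gamma$) is valuational (respectively, a group order).
   Context: Groups are written additively. A quasi-order (q.o) is a reflexive and transitive binary relation; every q.o and every order is assumed total. Write $a\sim b$ if $a\precsim b\precsim a$, and let $cl(a)$ be the $\sim$-class of $a$. A q.o $\precsim$ on a group is compatible (with the group operation) if: $(Q_1)$ $cl(0)=\{0\}$; $(Q_2)$ for all $x,y,z$, if $x\precsim y$ and $y\nsim z$, then $x+z\precsim y+z$. A subset $B$ of a quasi-ordered set $(A,\precsim)$ is $\precsim$-convex (in $A$) if for all $a\in A$ and $b,c\in B$, $b\precsim a\precsim c$ implies $a\in B$. A valuation on a group $G$ is a map $v$ from $G$ to a totally ordered set $\Gamma\cup\{\infty\}$ with maximum $\infty$ ($\infty\notin\Gamma$) such that for all $g,h,x\in G$: $v(g)=\infty\Leftrightarrow g=0$; $v(g-h)\geq\min(v(g),v(h))$; and $v(g)\leq v(h)\Rightarrow v(x+g-x)\leq v(x+h-x)$ (the last condition is vacuous for abelian groups). For $\gamma\in\Gamma$,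 $G^\gamma=\{g\in G\mid v(g)\geq\gamma\}$ and $G_\gamma=\{g\in G\mid v(g)>\gamma\}$. For a subgroup $H$ of a group $L$ (here $L=G^\gamma$, $H=G_\gamma$), $\precsim$ induces a q.o on $L/H$ if the relation $g_1+H\precsim g_2+H\Leftrightarrow\exists h_1,h_2\in H,\ g_1+h_1\precsim g_2+h_2$ on $L/H$ is transitive; this relation is then called the q.o induced by $\precsim$ on $L/H$. The valuation $v$ is compatible with $\precsim$ if for all $g,h\in G$, $0\precsim g\precsim h$ implies $v(g)\geq v(h)$. A q.o $\precsim$ on a group is valuational if it is induced by some valuation $w$ on that group, i.e. $g\precsim h\Leftrightarrow w(g)\geq w(h)$. *)

(* Defs.v *)
From HB Require Import structures.
From mathcomp Require Import all_boot all_order all_algebra.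
From mathcomp Require Import boolp.

Set Implicit Arguments.
Unset Strict Implicit.
Unset Printing Implicit Defensive.

Import Order.TTheory GRing.Theory.
Local Open Scope ring_scope.
Local Open Scope quotient_scope.

(* Relations are boolean: [asbool] (written `[< _ >]) turns an arbitrary
   Prop-valued relation into one of this form. *)

Definition quasi_order (A : Type) (le : rel A) : Prop :=
  [/\ reflexive le, transitive le & total le].

Definition qo_sim (A : Type) (le : rel A) : rel A :=
  fun a b => le a b && le b a.

Definition qo_class (A : Type) (le : rel A) (a : A) : pred A :=
  [pred b | qo_sim le b a].

Definition compatible_qo (G : zmodType) (le : rel G) : Prop :=
  [/\ quasi_order le,
      qo_class le 0 =i pred1 0
    & forall x y z : G, le x y -> ~~ qo_sim le y z -> le (x + z) (y + z)].

Definition group_order (G : zmodType) (le : rel G) : Prop :=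
  [/\ reflexive le, antisymmetric le, transitive le, total le
    & forall x y z : G, le x y -> le (x + z) (y + z)].

Definition qo_convex (A : Type) (le : rel A) (B : {pred A}) : Prop :=
  forall a b c : A, b \in B -> c \in B -> le b a -> le a c -> a \in B.

(* [Gam] is the whole of $\Gamma\cup\{\infty\}$, with $\infty$ = [\top].  The
   axiom on conjugates is omitted, since the groups are abelian. *)
Record valuation (G : zmodType) (d : Order.disp_t) (Gam : tOrderType d) :=
  Valuation {
    valuation_fun :> G -> Gam;
    valuation_top : forall g, valuation_fun g = \top%O <-> g = 0;
    valuation_sub : forall g h,
      (Order.min (valuation_fun g) (valuation_fun h) <= valuation_fun (g - h))%O
  }.

(* $\Gamma$ itself, i.e. [Gam] without $\infty$. *)
Definition finite_values (d : Order.disp_t) (Gam : tOrderType d) : Type :=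
  {gam : Gam | gam != \top%O}.

Definition valuational (G : zmodType) (le : rel G) : Prop :=
  exists (d : Order.disp_t) (Gam : tOrderType d) (w : valuation G Gam),
    forall g h : G, le g h <-> (w h <= w g)%O.

Definition valuation_compatible (G : zmodType) (le : rel G)
    (d : Order.disp_t) (Gam : tOrderType d) (v : valuation G Gam) : Prop :=
  forall g h : G, le 0 g -> le g h -> (v h <= v g)%O.

Section Induced.
Variables (L : zmodType) (le : rel L) (H : zmodClosed L).

Definition quot_rel : rel (Quotient.quot H) := fun q1 q2 =>
  `[< exists g1 g2 : L, [/\ q1 = \pi g1, q2 = \pi g2
      & exists h1 h2 : L, [/\ h1 \in H, h2 \in H & le (g1 + h1) (g2 + h2)]] >].

Lemma quot_relE (g1 g2 : L) :
  quot_rel (\pi g1) (\pi g2) <->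
  exists h1 h2 : L, [/\ h1 \in H, h2 \in H & le (g1 + h1) (g2 + h2)].
Proof.
split=> [/asboolP[k1 [k2 [/eqP e1 /eqP e2 [h1 [h2 [H1 H2 l]]]]]]|[h1 [h2 Hh]]].
  move: e1 e2; rewrite -!Quotient.idealrBE => e1 e2.
  have shift (g k h : L) : g + (h - (g - k)) = k + h.
    by rewrite opprB addrCA subrKC addrC.
  exists (h1 - (g1 - k1)), (h2 - (g2 - k2)).
  by rewrite !shift (rpredB H1 e1) (rpredB H2 e2).
by apply/asboolP; exists g1, g2; split=> //; exists h1, h2.
Qed.

Definition induces_qo : Prop := transitive quot_rel.

End Induced.

Section ValuationSubgroups.
Variables (G : zmodType) (d : Order.disp_t) (Gam : tOrderType d).
Variables (v : valuation G Gam) (gam : finite_values Gam).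

(* $G^\gamma$ and $G_\gamma$ *)
Definition upper_set : {pred G} := fun g => (\val gam <= v g)%O.
Definition lower_set : {pred G} := fun g => (\val gam < v g)%O.

Lemma upper_set_closed : zmod_closed upper_set.
Proof.
split=> [|x y xU yU]; rewrite unfold_in.
  by rewrite (valuation_top v 0).2 // lex1.
by apply: le_trans (valuation_sub v x y); rewrite le_min; apply/andP.
Qed.

HB.instance Definition _ := GRing.isZmodClosed.Build G upper_set upper_set_closed.

Definition upper : Type := {g : G | g \in upper_set}.
HB.instance Definition _ := SubChoice.on upper.
HB.instance Definition _ := [SubChoice_isSubZmodule of upper by <:].

(* $G_\gamma$ as a subgroup of $G^\gamma$ *)
Definition lower_in_upper : {pred upper} := fun g => \val g \in lower_set.

Lemma lower_in_upper_closed : zmod_closed lower_in_upper.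
Proof.
split=> [|x y xU yU]; rewrite unfold_in /lower_in_upper unfold_in.
  by rewrite raddf0 (valuation_top v 0).2 // lt_neqAle (valP gam) lex1.
rewrite raddfB; apply: lt_le_trans (valuation_sub v _ _).
by rewrite lt_min; apply/andP.
Qed.

HB.instance Definition _ :=
  GRing.isZmodClosed.Build upper lower_in_upper lower_in_upper_closed.

Definition upper_rel (le : rel G) : rel upper :=
  fun g h => le (\val g) (\val h).

Definition graded_piece : zmodType := Quotient.quot lower_in_upper.

Definition graded_rel (le : rel G) : rel graded_piece :=
  @quot_rel upper (upper_rel le) lower_in_upper.

Definition induces_compatible_qo (le : rel G) : Prop :=
  induces_qo (upper_rel le) lower_in_upper /\ compatible_qo (graded_rel le).

End ValuationSubgroups.

Arguments graded_rel {G d Gam} v gam le.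

(* Main.v *)
(** A nonzero [g] of a compatible q.o. either has exactly one of [g], [-g] below
[0], or satisfies [0 <= g] and [0 <= -g], in which case [g ~ -g].  The q.o. is
valuational iff every element is nonnegative, and it is a group order iff no
nonzero [g] satisfies [0 <= g] and [0 <= -g].

If [H] is a convex subgroup, the elements outside [H] lie strictly on one side
of [H] and keep their side under translation by [H].  It follows that the
induced relation on the quotient is [a <= b \/ a - b \in H], which is a
compatible q.o.  Both sign conditions then pass from [G] to the graded pieces,
and back because a nonzero [g] survives in the piece of index [v g]. *)
From HB Require Import structures.
Require Import Defs.
From mathcomp Require Import all_boot all_order all_algebra.

Set Implicit Arguments.
Unset Strict Implicit.
Unset Printing Implicit Defensive.

Import Order.TTheory GRing.Theory.
Local Open Scope ring_scope.
Local Open Scope quotient_scope.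

(** * Signs in a compatible q.o. and a sign criterion for group orders *)

Section CompatibleQO.
Context (G : zmodType) (le : rel G) (hle : compatible_qo le).

Lemma qo_refl x : le x x.
Proof. by case: hle => -[+ _ _] _ _; apply. Qed.

Lemma qo_trans y x z : le x y -> le y z -> le x z.
Proof. by case: hle => -[_ + _] _ _; apply. Qed.

Lemma qo_ltW x y : ~~ le x y -> le y x.
Proof. by case: hle => -[_ _ /(_ x y)] + _ _ => /orP[->|]. Qed.

Lemma qo_anti0 x : le 0 x -> le x 0 -> x = 0.
Proof.
by case: hle => _ /(_ x) + _ le0x lex0; rewrite !inE /qo_sim lex0 le0x => /esym/eqP.
Qed.

Lemma qo_leD x y z : le x y -> ~~ (le y z && le z y) -> le (x + z) (y + z).
Proof. by case: hle => _ _; apply. Qed.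

(** Add [- x] to [x <= 0]: (Q2) applies, since [- x ~ 0] would force [x = 0]. *)
Lemma qo_oppr_ge0 x : ~~ le 0 x -> le 0 (- x).
Proof.
move=> xlt0; have := @qo_leD x 0 (- x) (qo_ltW xlt0).
rewrite subrr add0r; apply; apply/negP => /andP[/qo_anti0 + {}/[dup] lex0].
move=> /(_ lex0)/eqP; rewrite oppr_eq0 => /eqP x0.
by rewrite x0 qo_refl in xlt0.
Qed.

(** Otherwise [x] and [- x] are inequivalent, and adding [- x] to [0 <= x] gives [- x <= 0], so
    [x = 0]. Applied to [- x] as well, this yields [x ~ - x]. *)
Lemma qo_le_oppr_nneg x : le 0 x -> le 0 (- x) -> le x (- x).
Proof.
move=> x0 Nx0; apply/negPn/negP => xNx.
have := @qo_leD 0 x (- x) x0; rewrite (negbTE xNx) add0r subrr => /(_ isT) Nx_le0.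
by move: xNx; rewrite -{1}[x]opprK (qo_anti0 Nx0 Nx_le0) oppr0 qo_refl.
Qed.

(** Adding [- y] gives [x - y <= 0], as [y < 0 <= - y]; then add [- x], which is not equivalent to
    [0]. *)
Lemma qo_oppr_neg x y : le x y -> ~~ le 0 y -> le (- y) (- x).
Proof.
move=> lexy ylt0; have Ny0 := qo_oppr_ge0 ylt0.
have xlt0 : ~~ le 0 x by apply: contra ylt0 => /qo_trans; apply.
have le0 : le (x - y) 0.
  rewrite -(subrr y); apply: qo_leD => //; apply: contra ylt0.
  by move=> /andP[_]; apply: qo_trans.
have := @qo_leD _ _ (- x) le0; rewrite add0r addrAC subrr add0r; apply.
apply: contra xlt0 => /andP[Nx_ge0 Nx_le0].
by rewrite -[x]opprK (qo_anti0 Nx_ge0 Nx_le0) oppr0 qo_refl.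
Qed.

Lemma valuational_ge0 : valuational le -> forall g, le 0 g.
Proof.
by move=> [d [Gam [w wE]]] g; apply/wE; rewrite (valuation_top w 0).2 // lex1.
Qed.

(** For the converse, [y] and [- y] are inequivalent when [y] is nonzero, so subtracting [y] is
    allowed and [~] is equality. The case [y ~ z] left open by (Q2) then becomes [y = z]. *)
Lemma group_orderP :
  group_order le <-> forall g, le 0 g -> le 0 (- g) -> g = 0.
Proof.
split=> [[_ _ _ _ leD] g g0 Ng0|sgn].
  by apply: qo_anti0 => //; have := leD _ _ g Ng0; rewrite add0r addNr.
have nsimN y : y != 0 -> ~~ (le y (- y) && le (- y) y).
  apply: contra => /andP[yN Ny]; apply/eqP.
  have [y0|/[dup] y0 /qo_oppr_ge0 Ny0] := boolP (le 0 y); apply: sgn => //.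
  - by apply: qo_trans yN.
  - by apply: qo_trans Ny.
have anti x y : le x y -> le y x -> x = y.
  have [->|y0] := eqVneq y 0 => xy yx; first by apply: qo_anti0.
  apply/eqP; rewrite -subr_eq0; apply/eqP/qo_anti0.
    rewrite -(subrr y); apply: qo_leD => //; apply: contra (nsimN y y0) => /andP[].
    by move=> xN Nx; rewrite (qo_trans yx xN) (qo_trans Nx xy).
  by rewrite -(subrr y); apply: qo_leD => //; exact: nsimN.
split; [exact: qo_refl| |by move=> y x z; exact: qo_trans| |].
- by move=> x y /andP[]; exact: anti.
- by case: hle => -[].
move=> x y z lexy; have [eyz|] := boolP (le y z && le z y); last exact: qo_leD.
have {eyz} <- : y = z by case/andP: eyz; apply: anti.
apply/negPn/negP => /[dup] /qo_ltW lt nle.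
have [y0|y0] := eqVneq y 0; first by rewrite y0 !addr0 -y0 lexy in nle.
(* Adding [- y] to [2y <= x + y] gives [y <= x], hence the absurd [x = y], unless [x + y ~ - y]. *)
have [e|ne] := boolP (le (x + y) (- y) && le (- y) (x + y)).
  (* Here [x = - 2y], and then [3y = 0]. *)
  have {e} xyE : x + y = - y by case/andP: e; apply: anti.
  have xE : x = - y - y by apply/(canRL (addrK y)).
  (* Add [y] to [2y <= x + y = - y], and [2y] to [- 2y = x <= y]. Once [3y = 0],
     [x + y = - y = 2y]. *)
  have y3_le0 : le (y + y + y) 0.
    rewrite -(addNr y); apply: qo_leD; first by rewrite -xyE.
    by rewrite andbC; exact: nsimN.
  have y3_ge0 : le 0 (y + y + y).
    have := @qo_leD _ _ (y + y) lexy; rewrite xE -opprD addNr addrA; apply.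
    apply/negP => /andP[l1 l2]; have /esym/eqP := anti _ _ l1 l2.
    by rewrite -subr_eq0 addrK (negbTE y0).
  have /eqP := qo_anti0 y3_ge0 y3_le0; rewrite addr_eq0 => /eqP y2E.
  by rewrite xyE y2E qo_refl in nle.
have := qo_leD lt ne; rewrite !addrK => leyx.
by rewrite (anti _ _ lexy leyx) qo_refl in nle.
Qed.

(** A canonical representative: [choose] depends neither on how the predicate is presented nor on
    which of its points is the default. *)
Definition qo_repr (g : G) : G := choose (qo_sim le g) g.

Lemma qo_reprP g : qo_sim le g (qo_repr g).
Proof. by apply: chooseP; rewrite /qo_sim !qo_refl. Qed.

Lemma qo_repr_eq g h : qo_sim le g h -> qo_repr g = qo_repr h.
Proof.
move=> /[dup] gh /andP[legh lehg]; rewrite /qo_repr.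
have /eq_choose -> : qo_sim le g =1 qo_sim le h.
  move=> x; rewrite /qo_sim; apply/andP/andP => -[l1 l2].
    by split; [apply: qo_trans l1|apply: qo_trans legh].
  by split; [apply: qo_trans l1|apply: qo_trans lehg].
by apply: choose_id; rewrite /qo_sim ?qo_refl // lehg legh.
Qed.

End CompatibleQO.

(** * The valuation attached to a q.o. whose elements are all nonnegative *)

Fact qo_display : Order.disp_t. Proof. exact: (Order.Disp tt tt). Qed.

(* The value set of the valuation attached to a q.o.: the set of classes of
   [~], realized by representatives, with the reversed order and [\top = cl(0)]. *)
Definition qo_value (G : zmodType) (le : rel G) (hle : compatible_qo le)
  (nneg : forall g, le 0 g) : Type := {g : G | qo_repr le g == g}.

Section QOValue.
Context (G : zmodType) (le : rel G) (hle : compatible_qo le).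
Context (nneg : forall g, le 0 g).
Local Notation value := (qo_value hle nneg).

HB.instance Definition _ := SubChoice.on value.

Definition qo_value_of (g : G) : value.
Proof.
by exists (qo_repr le g); apply/eqP/esym/qo_repr_eq => //; exact: qo_reprP.
Defined.

Definition qo_value_le : rel value := fun a b => le (val b) (val a).

Lemma qo_value_le_refl : reflexive qo_value_le.
Proof. by move=> a; exact: qo_refl. Qed.

Lemma qo_value_le_anti : antisymmetric qo_value_le.
Proof.
move=> a b ab; apply: val_inj.
by rewrite -(eqP (valP a)) -(eqP (valP b)); apply: qo_repr_eq; rewrite // /qo_sim andbC.
Qed.

Lemma qo_value_le_trans : transitive qo_value_le.
Proof. by move=> b a c ab bc; apply: qo_trans ab. Qed.

HB.instance Definition _ := Order.Le_isPOrder.Build qo_display value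
  qo_value_le_refl qo_value_le_anti qo_value_le_trans.

Lemma qo_value_le_total : total (<=%O : rel value).
Proof. by move=> a b; case: hle => -[_ _ t] _ _; exact: t. Qed.

HB.instance Definition _ :=
  Order.POrder_isTotal.Build qo_display value qo_value_le_total.

Lemma qo_value_ofE g h : (qo_value_of h <= qo_value_of g)%O = le g h.
Proof.
have /andP[g1 g2] := qo_reprP hle g; have /andP[h1 h2] := qo_reprP hle h.
change (le (qo_repr le g) (qo_repr le h) = le g h); apply/idP/idP => l.
  by apply: (qo_trans hle) g1 (qo_trans hle l h2).
by apply: (qo_trans hle) g2 (qo_trans hle l h1).
Qed.

Lemma qo_value_le_top (a : value) : (a <= qo_value_of 0)%O.
Proof.
have /andP[_ r0] := qo_reprP hle 0.
by apply: (qo_trans hle) r0 (nneg _).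
Qed.

HB.instance Definition _ :=
  Order.hasTop.Build qo_display value qo_value_le_top.

Lemma qo_value_of_top g : qo_value_of g = \top%O <-> g = 0.
Proof.
split=> [e|->//]; apply: (qo_anti0 hle) => //.
by rewrite -qo_value_ofE e.
Qed.

(** Otherwise [g - h] is strictly above both [g] and [h]; being inequivalent to [h], it can be added
    to [0 <= h], which gives [g - h <= g]. *)
Lemma qo_value_of_sub g h :
  (Order.min (qo_value_of g) (qo_value_of h) <= qo_value_of (g - h))%O.
Proof.
rewrite ge_min !qo_value_ofE; apply/negPn/negP; rewrite negb_or => /andP[l1 l2].
have := @qo_leD _ _ hle 0 h (g - h) (nneg h).
by rewrite (negbTE l2) andbF add0r [h + _]addrC subrK (negbTE l1) => /(_ isT).
Qed.

Lemma ge0_valuational : valuational le.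
Proof.
exists qo_display, value.
by exists (Valuation qo_value_of_top qo_value_of_sub) => g h; rewrite qo_value_ofE.
Qed.

End QOValue.

(** * The quotient by a convex subgroup *)

Section ConvexSubgroup.
Context (L : zmodType) (le : rel L) (hle : compatible_qo le).
Context (H : zmodClosed L) (Hcvx : qo_convex le H).

Let trans := qo_trans hle.

Lemma notin_nsim a h : a \notin H -> h \in H -> ~~ (le a h && le h a).
Proof. by move=> aH hH; apply: contra aH => /andP[ah ha]; apply: Hcvx ha ah. Qed.

Lemma notin_pos_gt a h : a \notin H -> h \in H -> le 0 a -> ~~ le a h.
Proof. by move=> aH hH a0; apply: contra aH; apply: Hcvx a0; rewrite ?rpred0. Qed.

Lemma notin_neg_lt a h : a \notin H -> h \in H -> ~~ le 0 a -> ~~ le h a.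
Proof.
move=> aH hH /(qo_ltW hle) a0; apply: contra aH => ha.
by apply: Hcvx ha a0; rewrite ?rpred0.
Qed.

Lemma notin_addr a h : a \notin H -> h \in H -> a + h \notin H.
Proof. by move=> aH hH; rewrite rpredDr. Qed.

(** A negative [a + h] would lie strictly below all of [H], but adding [h] to [0 <= a] gives
    [h <= a + h]. *)
Lemma notin_pos_addr a h : a \notin H -> h \in H -> le 0 a -> le 0 (a + h).
Proof.
move=> aH hH a0; apply/negPn/negP.
move=> /(notin_neg_lt (notin_addr aH hH) hH)/negP; apply.
by rewrite -[X in le X _]add0r; apply: qo_leD => //; exact: notin_nsim.
Qed.

Lemma notin_addr_pos a h : a \notin H -> h \in H -> le 0 (a + h) = le 0 a.
Proof.
move=> aH hH; apply/idP/idP; last exact: notin_pos_addr.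
by rewrite -[X in _ -> le 0 X](addrK h); apply: notin_pos_addr; rewrite ?notin_addr ?rpredN.
Qed.

(** For [h >= 0], add [b] to [0 <= h]. Otherwise the same argument with [- b] and [- h] gives
    [- b <= - (b + h)], and both sides are equivalent to their opposites. *)
Lemma notin_nneg_le_addr b h :
  b \notin H -> h \in H -> le 0 b -> le 0 (- b) -> le b (b + h).
Proof.
move=> bH hH b0 Nb0; have [h0|] := boolP (le 0 h).
  rewrite addrC -[X in le X _]add0r; apply: qo_leD => //.
  by rewrite andbC; exact: notin_nsim.
move=> /(qo_oppr_ge0 hle) Nh0.
have NbH : - b \notin H by rewrite rpredN.
have NhH : - h \in H by rewrite rpredN.
have l1 : le (- b) (- (b + h)).
  rewrite opprD addrC -[X in le X _]add0r; apply: qo_leD => //.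
  by rewrite andbC; exact: notin_nsim.
apply: trans (qo_le_oppr_nneg hle b0 Nb0) _; apply: trans l1 _.
have bh0 : le 0 (b + h) by rewrite notin_addr_pos.
by rewrite -[X in le _ X]opprK qo_le_oppr_nneg ?opprK // opprD notin_addr_pos.
Qed.

Lemma qo_le_of_addr_le a b h1 h2 : h1 \in H -> h2 \in H ->
  le (a + h1) (b + h2) -> a - b \notin H -> le a b.
Proof.
move=> h1H h2H l abH; apply/negPn/negP => nab; have ba := qo_ltW hle nab.
(* If one of [a], [b] is in [H], the sign of the other contradicts either [b <= a] or [l]. *)
have [aH|aH] := boolP (a \in H).
  have bH : b \notin H by apply: contra abH => /(rpredB aH).
  have [b0|b0] := boolP (le 0 b).
    by have := notin_pos_gt bH aH b0; rewrite ba.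
  have := @notin_neg_lt (b + h2) (a + h1).
  by rewrite notin_addr // notin_addr_pos // l rpredD // b0 => /(_ isT isT isT).
have [bH|bH] := boolP (b \in H).
  have [a0|a0] := boolP (le 0 a).
    have := @notin_pos_gt (a + h1) (b + h2).
    by rewrite notin_addr // notin_addr_pos // l rpredD // a0 => /(_ isT isT isT).
  by have := notin_neg_lt aH bH a0; rewrite ba.
have hH : h2 - h1 \in H by rewrite rpredB.
have {l} labh : le a (b + (h2 - h1)).
  rewrite addrA -[X in le X _](addrK h1); apply: qo_leD => //.
  by apply: notin_nsim; rewrite ?notin_addr ?rpredN.
move: (h2 - h1) hH labh => h hH labh.
have bh0E := notin_addr_pos bH hH.
(* If [b] and [- b] are both nonnegative, translation by [H] preserves the class of [b]. Otherwise
   [- b] may be added to [b <= a <= b + h], so [a - b] lies between [0] and [h]. *)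
have [/andP[b0 Nb0]|bo] := boolP (le 0 b && le 0 (- b)).
  suff : le (b + h) b by move/(trans labh); rewrite (negbTE nab).
  rewrite -[X in le _ X](addrK h).
  apply: notin_nneg_le_addr; rewrite ?notin_addr ?rpredN ?bh0E //.
  by rewrite opprD notin_pos_addr ?rpredN.
have nsim x : le 0 x = le 0 b -> ~~ (le x (- b) && le (- b) x).
  move=> xb; apply/negP => /andP[x1 x2].
  have [b0|b0] := boolP (le 0 b).
    by move: bo; rewrite b0 (trans _ x1) // xb.
  by have := trans (qo_oppr_ge0 hle b0) x2; rewrite xb (negbTE b0).
have a0E : le 0 a = le 0 b.
  apply/idP/idP => [a0|b0]; last exact: trans ba.
  by rewrite -bh0E (trans a0).
move/negP: abH; apply; apply: (Hcvx (b := 0) (c := h)) => //.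
- by rewrite rpred0.
- by rewrite -(subrr b); apply: qo_leD => //; exact: nsim.
have := qo_leD hle labh (nsim _ bh0E).
by rewrite [b + h]addrC addrK.
Qed.

(** Comparing cosets amounts to comparing arbitrary representatives, unless the cosets coincide. *)
Lemma quot_rel_convexE (a b : L) :
  quot_rel le (\pi_(Quotient.quot H) a) (\pi_(Quotient.quot H) b)
  = le a b || (a - b \in H).
Proof.
apply/idP/orP => [/quot_relE[h1 [h2 [h1H h2H l]]]|].
  have [?|abH] := boolP (a - b \in H); [by right|left].
  exact: qo_le_of_addr_le l abH.
move=> lab; apply/quot_relE; case: lab => [lab|abH].
  by exists 0, 0; rewrite !rpred0 !addr0.
by exists 0, (a - b); rewrite rpred0 addr0 [b + _]addrC subrK qo_refl.
Qed.

Lemma pi_quot_eq (a b : L) :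
  (\pi_(Quotient.quot H) a == \pi_(Quotient.quot H) b) = (a - b \in H).
Proof. by rewrite Quotient.idealrBE. Qed.

Lemma quot_rel_trans : transitive (@quot_rel L le H).
Proof.
move=> q2 q1 q3; rewrite -(reprK q1) -(reprK q2) -(reprK q3).
move: (repr q1) (repr q2) (repr q3) => a b c.
rewrite (quot_rel_convexE a b) -pi_quot_eq => /orP[ab|/eqP->//].
rewrite (quot_rel_convexE b c) -pi_quot_eq => /orP[bc|/eqP<-];
  by rewrite quot_rel_convexE ?(trans ab bc) ?ab.
Qed.

Lemma quot_rel_compatible : compatible_qo (@quot_rel L le H).
Proof.
split; [split| |].
- by move=> q; rewrite -(reprK q) quot_rel_convexE qo_refl.
- exact: quot_rel_trans.
- move=> q1 q2; rewrite -(reprK q1) -(reprK q2) !quot_rel_convexE.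
  by case: hle => -[_ _ /(_ (repr q1) (repr q2))/orP[]->] _ _; rewrite ?orbT.
- move=> q; rewrite -(reprK q); move: (repr q) => a.
  rewrite !inE /qo_sim -(raddf0 \pi_(Quotient.quot H)).
  rewrite pi_quot_eq !quot_rel_convexE sub0r subr0 rpredN.
  have [aH|aH] := boolP (a \in H); first by rewrite !orbT.
  rewrite !orbF; apply/negP => /andP[a0 a0'].
  by rewrite (qo_anti0 hle a0' a0) rpred0 in aH.
move=> q1 q2 q3; rewrite -(reprK q1) -(reprK q2) -(reprK q3).
move: (repr q1) (repr q2) (repr q3) => x y z.
rewrite (quot_rel_convexE x y) -pi_quot_eq => /orP[xy|/eqP->]; last first.
  by rewrite -raddfD quot_rel_convexE qo_refl.
(* Equivalent representatives have equivalent cosets, so (Q2) in [L] applies to [y] and [z]. *)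
rewrite /qo_sim !quot_rel_convexE -!raddfD quot_rel_convexE => nyz.
rewrite qo_leD //; apply: contra nyz => /andP[yz zy].
by rewrite yz zy.
Qed.

End ConvexSubgroup.

(** * Convexity, compatibility and signs in the graded pieces *)

Section GradedPieces.
Context (G : zmodType) (le : rel G) (hle : compatible_qo le).
Context (d : Order.disp_t) (Gam : tOrderType d) (v : valuation G Gam).

Lemma upper_rel_compatible gam : compatible_qo (upper_rel (v := v) (gam := gam) le).
Proof.
split; [split| |].
- by move=> x; exact: (qo_refl hle).
- by move=> y x z; exact: (qo_trans hle).
- by move=> x y; case: hle => -[_ _ t] _ _; exact: t.
- move=> x; rewrite !inE /qo_sim /upper_rel raddf0 -val_eqE /=.
  by case: hle => _ /(_ (\val x)) + _; rewrite !inE.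
by move=> x y z; rewrite /qo_sim /upper_rel !raddfD; exact: qo_leD.
Qed.

Lemma lower_in_upper_convex gam : qo_convex le (lower_set v gam) ->
  qo_convex (upper_rel le) (lower_in_upper (v := v) (gam := gam)).
Proof. by move=> cvx a b c; exact: cvx. Qed.

(** Treats both families of subgroups at once. A nonnegative [a] is compared with [c]; a negative
    one through [0 <= - a <= - b] and [v (- x) = v x]. *)
Lemma valuation_compatible_convex (P : pred Gam) :
  (forall x y, (x <= y)%O -> P x -> P y) ->
  valuation_compatible le v -> qo_convex le [pred g | P (v g)].
Proof.
move=> Pup cmp a b c; rewrite !inE => Pb Pc ba ac.
have vN x : v (- x) = v x.
  have le_vN y : (v y <= v (- y))%O.
    have := valuation_sub v 0 y.
    by rewrite sub0r (valuation_top v 0).2 // min_r ?lex1.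
  by apply/le_anti; rewrite le_vN andbT -{2}[x]opprK le_vN.
have [a0|a0] := boolP (le 0 a); first exact: Pup (cmp _ _ a0 ac) Pc.
apply: Pup Pb; rewrite -vN -[leRHS]vN.
by apply: cmp; [exact: qo_oppr_ge0|exact: qo_oppr_neg].
Qed.

Lemma upper_convex gam :
  valuation_compatible le v -> qo_convex le (upper_set v gam).
Proof.
by apply: (@valuation_compatible_convex (fun x => \val gam <= x)%O) => x y /[swap];
  exact: le_trans.
Qed.

Lemma lower_convex gam :
  valuation_compatible le v -> qo_convex le (lower_set v gam).
Proof.
by apply: (@valuation_compatible_convex (fun x => \val gam < x)%O) => x y /[swap];
  exact: lt_le_trans.
Qed.

Lemma upper_convex_compatible :
  (forall gam, qo_convex le (upper_set v gam)) -> valuation_compatible le v.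
Proof.
move=> cvx g h g0 gh; have [vh|vh] := eqVneq (v h) \top%O.
  have h0 := (valuation_top v h).1 vh.
  by rewrite h0 in gh *; rewrite (qo_anti0 hle g0 gh).
(* With index [v h], both [0] and [h] lie in the subgroup, hence so does [g]. *)
apply: (cvx (exist _ (v h) vh) g 0 h) => //; rewrite unfold_in //=.
by rewrite (valuation_top v 0).2 // lex1.
Qed.

Definition graded_pi gam (g : upper v gam) : graded_piece v gam :=
  \pi_(Quotient.quot (lower_in_upper (v := v) (gam := gam))) g.

Lemma graded_pi_surj gam (q : graded_piece v gam) : exists g, q = graded_pi g.
Proof. by exists (repr q); rewrite /graded_pi reprK. Qed.

Lemma graded_pi0 gam : graded_pi (0 : upper v gam) = 0.
Proof. exact: (raddf0 \pi_(Quotient.quot _)). Qed.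

Lemma graded_piN gam (g : upper v gam) : graded_pi (- g) = - graded_pi g.
Proof. exact: (raddfN \pi_(Quotient.quot _)). Qed.

Lemma upper_valN gam (g : upper v gam) : \val (- g) = - \val g.
Proof. exact: raddfN. Qed.

Lemma graded_pi_eq0 gam (g : upper v gam) :
  (graded_pi g == 0) = (\val gam < v (\val g))%O.
Proof. by rewrite -graded_pi0 pi_quot_eq subr0. Qed.

Definition value_at (g : G) (g0 : g != 0) : finite_values Gam.
Proof.
by exists (v g); apply: contra g0 => /eqP vg; apply/eqP/(valuation_top v).
Defined.

(** If [v g < v h], then in the piece of index [v g] the class of [h] is [0], so that of [g] is
    equivalent to [0] and vanishes by (Q1), which is absurd. *)
Lemma induces_valuation_compatible :
  (forall gam, induces_compatible_qo v gam le) -> valuation_compatible le v.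
Proof.
move=> ind g h g0 gh; rewrite leNgt; apply/negP => vgh.
have gN0 : g != 0.
  apply/eqP => g_0; move: vgh; rewrite g_0 (valuation_top v 0).2 //.
  by rewrite ltNge lex1.
set gam := value_at gN0; have [_ cgr] := ind gam.
have gU : g \in upper_set v gam by rewrite unfold_in /=.
have hU : h \in upper_set v gam by rewrite unfold_in /= ltW.
pose g' : upper v gam := exist _ g gU; pose h' : upper v gam := exist _ h hU.
have piW x y : upper_rel le x y -> graded_rel v gam le (graded_pi x) (graded_pi y).
  by move=> xy; apply/quot_relE; exists 0, 0; rewrite !rpred0 !addr0.
have /eqP h0 : graded_pi h' == 0 by rewrite graded_pi_eq0.
suff /eqP : graded_pi g' = 0 by rewrite graded_pi_eq0 ltxx.
apply: (qo_anti0 cgr); last by rewrite -h0; apply: piW.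
by rewrite -graded_pi0; apply: piW; rewrite /upper_rel raddf0.
Qed.

Lemma convex_induces gam :
  qo_convex le (lower_set v gam) -> induces_compatible_qo v gam le.
Proof.
move=> /lower_in_upper_convex cvx.
split; [apply: quot_rel_trans cvx|apply: quot_rel_compatible cvx];
  exact: upper_rel_compatible.
Qed.

(** A nonzero class has the sign of each of its representatives; this carries both sign criteria
    between [G] and the pieces. *)
Lemma graded_pi_ge0 gam (g : upper v gam) : valuation_compatible le v ->
  graded_rel v gam le 0 (graded_pi g) = le 0 (\val g) || (graded_pi g == 0).
Proof.
move=> /(@lower_convex gam)/lower_in_upper_convex cvx.
rewrite -{1}graded_pi0 /graded_rel quot_rel_convexE //; last exact: upper_rel_compatible.
by rewrite /upper_rel raddf0 graded_pi_eq0 sub0r rpredN.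
Qed.

Lemma graded_pi_neq0 g (g0 : g != 0) :
  exists2 x : upper v (value_at g0), \val x = g & graded_pi x != 0.
Proof.
by exists (exist _ g (lexx (v g))) => //; rewrite graded_pi_eq0 ltxx.
Qed.

End GradedPieces.

Theorem theorem2p2 (G : zmodType) (le : rel G) (hle : compatible_qo le)
    (d : Order.disp_t) (Gam : tOrderType d) (v : valuation G Gam) :
  [<-> forall gam : finite_values Gam, qo_convex le (upper_set v gam);
       forall gam : finite_values Gam, qo_convex le (lower_set v gam);
       forall gam : finite_values Gam, induces_compatible_qo v gam le;
       valuation_compatible le v]
  /\ (valuation_compatible le v ->
        (valuational le <->
           forall gam : finite_values Gam, valuational (graded_rel v gam le))
        /\
        (group_order le <->
           forall gam : finite_values Gam, group_order (graded_rel v gam le))).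
Proof.
split.
  tfae.
  - move=> /(upper_convex_compatible hle) cmp gam.
    exact: lower_convex.
  - by move=> cvx gam; apply: convex_induces.
  - exact: induces_valuation_compatible.
  - by move=> cmp gam; apply: upper_convex.
move=> cmp.
have cgr gam : compatible_qo (graded_rel v gam le).
  by case: (convex_induces hle (lower_convex hle (gam := gam) cmp)).
split; split=> [vle gam|vgr].
- apply: (ge0_valuational (cgr gam)) => q; have [g ->] := graded_pi_surj q.
  by rewrite (graded_pi_ge0 hle) // valuational_ge0.
- apply: ge0_valuational => // g.
  have [->|g0] := eqVneq g 0; first exact: qo_refl.
  have [x xE xN0] := graded_pi_neq0 v g0.
  have := valuational_ge0 (vgr _) (graded_pi x).
  by rewrite (graded_pi_ge0 hle) // (negbTE xN0) orbF xE.
- apply/(group_orderP (cgr gam)) => q; have [g ->] := graded_pi_surj q.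
  (* If a nonzero class and its opposite are nonnegative, so are [g] and [- g]; then [g = 0], and
     its class is zero. *)
  rewrite -graded_piN !(graded_pi_ge0 hle) // graded_piN oppr_eq0.
  have [//|gN0] := eqVneq (graded_pi g) 0.
  rewrite !orbF upper_valN => le0g leg0; apply/eqP.
  rewrite graded_pi_eq0 ((group_orderP hle).1 vle _ le0g leg0).
  by rewrite (valuation_top v 0).2 // lt_neqAle (valP gam) lex1.
apply/(group_orderP hle) => g le0g leg0; apply/eqP/negPn/negP => g0.
(* In the piece of index [v g], the class of [g] is nonzero and keeps both signs. *)
have [x xE xN0] := graded_pi_neq0 v g0.
have := (group_orderP (cgr _)).1 (vgr (value_at v g0)) (graded_pi x).
rewrite -graded_piN !(graded_pi_ge0 hle) // upper_valN xE le0g leg0.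
by move=> /(_ isT isT)/eqP; rewrite (negbTE xN0).
Qed.
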